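(* Let $(V,\lambda,q)$ be a nonsingular symmetric form $(V,\lambda)$ over $\mathbb{Z}_2$ together with a $\mathbb{Z}_4$-valued quadratic enhancement $q:V\to\mathbb{Z}_4$. If the Brown-Kervaire invariant $\mathrm{BK}(V,\lambda,q)\in\mathbb{Z}_8$ is divisible by $4$, then it can be expressed as the classical Arf invariant of a $\mathbb{Z}_2$-valued form, $$\mathrm{BK}(V,\lambda,q)=4\,\mathrm{Arf}\left(L^{\perp}/L,\ [\lambda],\ \frac{[q]}{2}\right)\in4\mathbb{Z}_2\subset\mathbb{Z}_8,$$ where $L^{\perp}=\{x\in V\mid\lambda(x,x)=0\in\mathbb{Z}_2\}$ and $L=\langle v\rangle$ with $v$ the characteristic element of $\lambda$ in $V$.
   Context: $V$ is a finite-dimensional $\mathbb{Z}_2$-vector space and $\lambda:V\times V\to\mathbb{Z}_2$ a nonsingular symmetric bilinear form. A $\mathbb{Z}_4$-valued quadratic enhancement is a function $q:V\to\mathbb{Z}_4$ with $q(x+y)=q(x)+q(y)+i\lambda(x,y)$, where $i=2:\mathbb{Z}_2\to\mathbb{Z}_4$. A $\mathbb{Z}_2$-valued quadratic enhancement is a function $h$ with $h(x+y)=h(x)+h(y)+\lambda(x,y)\in\mathbb{Z}_2$. The characteristic element (Wu class) is the unique $v\in V$ with $\lambda(x,x)=\lambda(x,v)$ for all $x\in V$. $\mathrm{BK}(V,\lambda,q)\in\mathbb{Z}_8$ is defined by $\sum_{x\in V}i^{q(x)}=\sqrt2^{\,\dim V}e^{2\pi i\,\mathrm{BK}(V,\lambda,q)/8}$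 ($i^2=-1$). The Arf invariant of $(W,\mu,h)$, with $h$ a $\mathbb{Z}_2$-valued quadratic enhancement of $\mu$, is $\sum_j h(e_j)h(\bar e_j)\in\mathbb{Z}_2$ for any symplectic basis $\{e_j,\bar e_j\}$ of $W$. On $L^\perp$, $q$ takes values in $2\mathbb{Z}_2\subset\mathbb{Z}_4$; $[\lambda]$ and $[q]$ denote the induced form and function on $L^\perp/L$, and $[q]/2$ is the $\mathbb{Z}_2$-valued function whose double is $[q]$. *)

(* Defs.v *)
From HB Require Import structures.
From mathcomp Require Import all_boot all_order all_algebra all_field.
From mathcomp Require Import reals trigo.
From mathcomp.real_closed Require Import complex.

Set Implicit Arguments.
Unset Strict Implicit.
Unset Printing Implicit Defensive.

Import GRing.Theory Num.Theory.
Local Open Scope ring_scope.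

Section VectorQuotient.
Variables (F : fieldType) (E : vectType F) (K : {vspace E}).

Definition vquot : Type := Quotient.quot (pred_of_vspace K).

HB.instance Definition _ :=
  EqQuotient.copy vquot (Quotient.quot (pred_of_vspace K)).
HB.instance Definition _ :=
  GRing.Zmodule.copy vquot (Quotient.quot (pred_of_vspace K)).
HB.instance Definition _ :=
  ZmodQuotient.copy vquot (Quotient.quot (pred_of_vspace K)).

Definition vquot_pi (x : E) : vquot := (\pi_vquot x)%qT.
Definition vquot_repr (w : vquot) : E := repr w.

Lemma vquot_reprK w : vquot_pi (vquot_repr w) = w.
Proof. exact: reprK. Qed.

Lemma eq_vquot_pi x y : (vquot_pi x == vquot_pi y) = (x - y \in K).
Proof. exact/esym/(Quotient.idealrBE (pred_of_vspace K)). Qed.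

Lemma vquot_repr_pi x : vquot_repr (vquot_pi x) - x \in K.
Proof. by rewrite -eq_vquot_pi vquot_reprK. Qed.

Lemma vquot_piD x y : vquot_pi (x + y) = vquot_pi x + vquot_pi y.
Proof. by rewrite /vquot_pi !piE. Qed.

Definition vquot_scale (a : F) (w : vquot) : vquot :=
  vquot_pi (a *: vquot_repr w).

Lemma vquot_scale_pi a x : vquot_scale a (vquot_pi x) = vquot_pi (a *: x).
Proof.
by apply/eqP; rewrite eq_vquot_pi -scalerBr rpredZ ?vquot_repr_pi.
Qed.

Fact vquot_scaleA a b w : 
  vquot_scale a (vquot_scale b w) = vquot_scale (a * b) w.
Proof. by rewrite -[w]vquot_reprK !vquot_scale_pi scalerA. Qed.

Fact vquot_scale1 : left_id 1 vquot_scale.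
Proof. by move=> w; rewrite -[w]vquot_reprK vquot_scale_pi scale1r. Qed.

Fact vquot_scaleDr : right_distributive vquot_scale +%R.
Proof.
move=> a w w'; rewrite -[w]vquot_reprK -[w']vquot_reprK -vquot_piD.
by rewrite !vquot_scale_pi -vquot_piD scalerDr.
Qed.

Fact vquot_scaleDl w : {morph vquot_scale^~ w : a b / a + b}.
Proof.
by move=> a b; rewrite -[w]vquot_reprK !vquot_scale_pi -vquot_piD scalerDl.
Qed.

HB.instance Definition _ := GRing.Zmodule_isLmodule.Build F vquot
  vquot_scaleA vquot_scale1 vquot_scaleDr vquot_scaleDl.

Fact vquot_pi_is_linear : linear vquot_pi.
Proof. by move=> a x y; rewrite vquot_piD -vquot_scale_pi. Qed.
HB.instance Definition _ :=
  GRing.isLinear.Build F E vquot _ vquot_pi vquot_pi_is_linear.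

Import VectorInternalTheory.

Fact vquot_vect_iso : Vector.axiom (dim (subvs_of K^C)) vquot.
Proof.
have KC0 : (K^C :&: K = 0)%VS by rewrite capvC capv_compl.
have K0 := capv_compl K.
pose g := daddv_pi K^C K.
have gD x : g x + daddv_pi K K^C x = x.
  by apply: daddv_pi_add; rewrite ?KC0 // addvC addv_complf memvf.
have gK x : x \in K -> g x = 0.
  move=> xK; apply: (addIr (daddv_pi K K^C x)).
  by rewrite gD add0r daddv_pi_id.
have gC x : g x \in (K^C)%VS by apply: memv_pi.
have g_repr x : g (vquot_repr (vquot_pi x)) = g x.
  by apply/eqP; rewrite -subr_eq0 -linearB /= gK ?vquot_repr_pi.
exists (fun w => v2r (vsproj K^C (g (vquot_repr w)))).
  move=> a w w'; rewrite -linearP -linearP; congr (v2r (vsproj _ _)).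
  by rewrite -linearP -[w in LHS]vquot_reprK -[w' in LHS]vquot_reprK -linearP g_repr.
exists (fun r => vquot_pi (vsval (r2v r : subvs_of K^C))) => [w|r].
  rewrite v2rK vsprojK // -[RHS]vquot_reprK; apply/eqP; rewrite eq_vquot_pi.
  by rewrite -opprB rpredN -{1}[vquot_repr w]gD addrC addKr memv_pi.
by rewrite g_repr /g daddv_pi_id ?subvsP // vsvalK r2vK.
Qed.
HB.instance Definition _ := Lmodule_hasFinDim.Build F vquot vquot_vect_iso.

End VectorQuotient.

(* The inclusions 2 : Z_2 -> Z_4 and 4 : Z_2 -> Z_8. *)
Definition two24 (a : 'F_2) : 'Z_4 := (2 * a)%N%:R.
Definition four28 (a : 'F_2) : 'Z_8 := (4 * a)%N%:R.
(* The inverse of [two24] on its image {0, 2}; junk on the odd classes. *)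
Definition half42 (z : 'Z_4) : 'F_2 := (z./2)%:R.

Section Forms.
Variable V : vectType 'F_2.

Definition Z4_enhancement (lambda : V -> V -> 'F_2) (q : V -> 'Z_4) : Prop :=
  forall x y, q (x + y) = q x + q y + two24 (lambda x y).

Definition Z2_enhancement (lambda : V -> V -> 'F_2) (h : V -> 'F_2) : Prop :=
  forall x y, h (x + y) = h x + h y + lambda x y.

Definition characteristic_element (lambda : V -> V -> 'F_2) (v : V) : Prop :=
  forall x, lambda x x = lambda x v.

Definition nonsingular_Z2_form (mu : V -> V -> 'F_2) (h : V -> 'F_2) : Prop :=
  [/\ bilinear_for *%R *%R mu, forall x y, mu x y = mu y x,
      forall x, (forall y, mu x y = 0) -> x = 0 & Z2_enhancement mu h].

(* A symplectic basis is recorded as the pair of families e_j and ebar_j. *)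
Definition half_basis : Type :=
  ((\dim {:V})./2).-tuple (finvect_type V).

Definition symplectic_basis (mu : V -> V -> 'F_2)
    (B : half_basis * half_basis) : bool :=
  basis_of {:V} (B.1 ++ B.2) &&
  [forall i, forall j,
    [&& mu (tnth B.1 i) (tnth B.1 j) == 0,
        mu (tnth B.2 i) (tnth B.2 j) == 0 &
        mu (tnth B.1 i) (tnth B.2 j) == (i == j)%:R]].

Definition Arf_sum (h : V -> 'F_2) (B : half_basis * half_basis) : 'F_2 :=
  \sum_j h (tnth B.1 j) * h (tnth B.2 j).

(* Evaluated on some symplectic basis; [Arf_basis] below shows that any other *)
(* one gives the same value. The value 0 is junk, used when there is none.    *)
Definition Arf (mu : V -> V -> 'F_2) (h : V -> 'F_2) : 'F_2 :=
  if [pick B | symplectic_basis mu B] is Some B then Arf_sum h B else 0.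

End Forms.

Section ArfBasis.
Variables (W : vectType 'F_2) (mu : W -> W -> 'F_2) (h : W -> 'F_2).
Hypothesis mu_h : nonsingular_Z2_form mu h.

Let sg (a : 'F_2) : int := (-1) ^+ a.

Let sgD a b : sg (a + b) = sg a * sg b.
Proof. by case: a b => [[|[|//]] ?] [[|[|//]] ?]. Qed.

Let sg_sum I (r : seq I) (F : I -> 'F_2) :
  sg (\sum_(i <- r) F i) = \prod_(i <- r) sg (F i).
Proof. by apply: (big_morph sg sgD). Qed.

Let muDl y : {morph mu^~ y : x x' / x + x'}.
Proof. by case: mu_h => -[ml _] _ _ _ x x'; have:= ml y 1 x x'; rewrite scale1r /= mul1r. Qed.

Let mu0l y : mu 0 y = 0.
Proof. by apply: (addrI (mu 0 y)); rewrite -muDl !addr0. Qed.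

Let muZl a x y : mu (a *: x) y = a * mu x y.
Proof. by case: mu_h => -[ml _] _ _ _; have:= ml y a x 0; rewrite addr0 mu0l addr0. Qed.

Let mu_sym x y : mu x y = mu y x. Proof. by case: mu_h. Qed.

Let mu_suml I (r : seq I) (u : I -> W) y :
  mu (\sum_(i <- r) u i) y = \sum_(i <- r) mu (u i) y.
Proof. exact: (big_morph (mu^~ y) (muDl y) (mu0l y)). Qed.

Let hD x y : h (x + y) = h x + h y + mu x y. Proof. by case: mu_h. Qed.

Let h0 : h 0 = 0.
Proof. by apply: (addrI (h 0)); rewrite -{3}[0]addr0 hD mu0l !addr0. Qed.

Let h_sum (I : eqType) (r : seq I) (u : I -> W) : uniq r ->
  (forall i j, i != j -> mu (u i) (u j) = 0) ->
  h (\sum_(i <- r) u i) = \sum_(i <- r) h (u i).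
Proof.
move=> Ur u0; elim: r Ur => [|i r IHr] /=; first by rewrite !big_nil h0.
case/andP=> ir Ur; rewrite !big_cons hD IHr // mu_sym mu_suml.
rewrite [X in _ + X]big_seq [X in _ + X]big1 ?addr0 // => j jr; apply: u0.
by apply: contraNneq ir => <-.
Qed.

Lemma Gauss_sum_Arf (B : half_basis W * half_basis W) : symplectic_basis mu B ->
  \sum_(x : finvect_type W) (-1) ^+ h x =
    2 ^+ (\dim {:W})./2 * (-1) ^+ Arf_sum h B :> int.
Proof.
case: B => e f /andP[/= B_basis /forallP B_sympl].
have ee i j : mu (tnth e i) (tnth e j) = 0.
  by have /forallP/(_ j)/and3P[/eqP] := B_sympl i.
have ff i j : mu (tnth f i) (tnth f j) = 0.
  by have /forallP/(_ j)/and3P[_ /eqP] := B_sympl i.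
have ef i j : mu (tnth e i) (tnth f j) = (i == j)%:R.
  by have /forallP/(_ j)/and3P[_ _ /eqP] := B_sympl i.
set n := (\dim {:W})./2 in e f B_basis B_sympl ee ff ef *.
pose T := ('F_2 * 'F_2)%type.
pose u (i : 'I_n) (c : T) : W := c.1 *: tnth e i + c.2 *: tnth f i.
pose L (g : {ffun 'I_n -> T}) : finvect_type W := \sum_i u i (g i).
have mu_e i c j : mu (u i c) (tnth e j) = c.2 * (i == j)%:R.
  by rewrite /u muDl !muZl ee mulr0 add0r mu_sym ef eq_sym.
have mu_f i c j : mu (u i c) (tnth f j) = c.1 * (i == j)%:R.
  by rewrite /u muDl !muZl ff mulr0 addr0 ef.
have mu_u i j c d : i != j -> mu (u i c) (u j d) = 0.
  move=> /negPf ij; rewrite {2}/u mu_sym muDl !muZl ![mu _ (u _ _)]mu_sym.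
  by rewrite mu_e mu_f ij !mulr0 addr0.
have coordL (g : {ffun 'I_n -> T}) j : g j = (mu (L g) (tnth f j), mu (L g) (tnth e j)).
  rewrite /L !mu_suml (bigD1 j) //= [X in (_, X)](bigD1 j) //= mu_e mu_f.
  rewrite !big1 => [|i /negPf ij|i /negPf ij]; rewrite ?mu_e ?mu_f ?ij ?mulr0 //.
  by rewrite eqxx !mulr1 !addr0; case: (g j).
have inj_L : injective L.
  by move=> g g' eqL; apply/ffunP => j; rewrite !coordL eqL.
have bij_L : bijective L.
  apply: inj_card_bij inj_L _.
  have dimW : \dim {:W} = (n + n)%N.
    have /andP[/eqP <- /eqP->] := B_basis; by rewrite size_cat !size_tuple.
  pose v2r (x : finvect_type W) := VectorInternalTheory.v2r (x : W).
  have /leq_card leW : injective v2r := can_inj VectorInternalTheory.v2rK.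
  rewrite (leq_trans leW) // card_mx card_ffun card_prod !card_ord /=.
  by rewrite mul1n -dimvf dimW expnD expnMn.
have hL g : h (L g) = \sum_i h (u i (g i)).
  by rewrite [LHS]h_sum ?index_enum_uniq // => i j ij; apply: mu_u.
rewrite (reindex L) /=; last exact: onW_bij.
under eq_bigr => g _ do rewrite hL -/(sg _) sg_sum.
rewrite -(bigA_distr_bigA (fun i c => sg (h (u i c)))) /=.
rewrite -/(sg _) /Arf_sum sg_sum /=.
rewrite -[X in 2 ^+ X]card_ord -prodr_const -big_split /=; apply: eq_bigr => i _.
rewrite -(pair_bigA _ (fun a b => sg (h (u i (a, b))))) /=.
rewrite !big_ord_recl !big_ord0 /u /= !addr0.
have -> : lift ord0 ord0 = 1 :> 'F_2 by apply: val_inj.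
have -> : ord0 = 0 :> 'F_2 by apply: val_inj.
rewrite !scale0r !scale1r !add0r !addr0 hD ef eqxx h0.
by case: (h _) (h _) => [[|[|//]] ?] [[|[|//]] ?].
Qed.

Lemma Arf_basis (B : half_basis W * half_basis W) :
  symplectic_basis mu B -> Arf mu h = Arf_sum h B.
Proof.
move=> B_sympl; rewrite /Arf; case: pickP => [B' B'_sympl|/(_ B)]; last first.
  by rewrite B_sympl.
have := Gauss_sum_Arf B_sympl; rewrite (Gauss_sum_Arf B'_sympl).
move/(mulfI (expf_neq0 _ (isT : (2 : int) != 0))).
by case: (Arf_sum h B) (Arf_sum h B') => [[|[|//]] ?] [[|[|//]] ?] //= _; apply: val_inj.
Qed.

End ArfBasis.

Definition expi (R : realType) (t : R) : R[i] := (cos t +i* sin t)%C.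

(* The exponents q x and b are read through their representatives in nat,     *)
(* which is harmless as 'i ^+ 4 = 1 and t |-> expi t has period 2 * pi. The   *)
(* equation determines b, and is solvable when q is a Z_4-valued enhancement  *)
(* of a nonsingular form; 0 is junk otherwise.                                *)
Definition BK (R : realType) (V : vectType 'F_2) (q : V -> 'Z_4) : 'Z_8 :=
  odflt 0 [pick b : 'Z_8 |
    \sum_(x : finvect_type V) 'i%C ^+ q x ==
      (Num.sqrt (2 : R))%:C%C ^+ \dim {:V} * expi (2 * pi * b%:R / 8)].

Section Subquotient.
Variables (V : vectType 'F_2) (lambda : {symmetric V}).

Definition self_pairing (x : V) : ('F_2)^o := lambda x x.

Fact self_pairing_is_linear : linear self_pairing.
Proof.
move=> a x y; rewrite /self_pairing !(linearDl, linearDr) /=.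
rewrite !(linearZl_LR, linearZr) /= (hermC lambda y x) expr0 mul1r /=.
have aa : a * a = a by case: a => [[|[|//]] ?]; apply: val_inj.
have dbl0 (b : 'F_2) : b + b = 0 by case: b => [[|[|//]] ?]; apply: val_inj.
rewrite mulrA aa /GRing.scale /= -!addrA; congr (_ + _).
by rewrite addrA dbl0 add0r.
Qed.
HB.instance Definition _ :=
  GRing.isLinear.Build 'F_2 V ('F_2)^o _ self_pairing self_pairing_is_linear.

Definition Lperp : {vspace V} := lker (linfun self_pairing).

Lemma mem_Lperp x : (x \in Lperp) = (lambda x x == 0).
Proof. by rewrite memv_ker lfunE. Qed.

Variable v : V.

(* L^perp / L with L = <v>. The preimage of L in L^perp is that of the        *)
(* intersection of L and L^perp; whether L <= L^perp is a separate question.  *)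
Definition LperpL : vectType 'F_2 :=
  vquot (linfun (vsval : subvs_of Lperp -> V) @^-1: <[v]>)%VS.

(* Functions on L^perp / L are computed on representatives.                   *)
Definition LperpL_pi (x : subvs_of Lperp) : LperpL := vquot_pi _ x.
Definition LperpL_repr (w : LperpL) : V := vsval (vquot_repr w).

Definition induced_form (w w' : LperpL) : 'F_2 :=
  lambda (LperpL_repr w) (LperpL_repr w').

Definition induced_half (q : V -> 'Z_4) (w : LperpL) : 'F_2 :=
  half42 (q (LperpL_repr w)).

End Subquotient.

(* Main.v *)
Require Import Defs.
From mathcomp Require Import all_boot all_order all_algebra all_field.
From mathcomp Require Import reals trigo.
From mathcomp.real_closed Require Import complex.
From mathcomp Require Import ring.

Set Implicit Arguments.
Unset Strict Implicit.
Unset Printing Implicit Defensive.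

Import Order.TTheory GRing.Theory Num.Theory.
Local Open Scope ring_scope.

(** Everything is read off the Gauss sum G, the sum of i^q(x) over x in V.

    The square of G is computed by the substitution y = x + z in the double sum
    of i^(q(x) + q(y)). Since 2 q(x) = 2 lambda(x, x) = 2 lambda(x, v), the sum
    over x for fixed z is that of the character (-1)^lambda(x, v + z), which
    vanishes unless z = v; thus G^2 = i^q(v) 2^(dim V) ([gauss_sqr]). It
    follows that G is sqrt(2)^(dim V) times an eighth root of unity, so that
    the Brown-Kervaire invariant satisfies its defining equation
    ([gauss_BK]), and that BK is congruent to q(v) modulo 4. When 4 divides BK
    this gives q(v) = 0 ([q_char_eq0]) and G > 0 or G < 0 according to whether
    BK is 0 or 4.

    Once q(v) = 0, the element v lies in L^perp, which is the orthogonal of v,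
    and q is invariant under translation by v on L^perp, where it is even; so
    lambda and q/2 descend to L^perp / L. The descended form is nonsingular
    because v and 0 are the only elements orthogonal to all of L^perp
    ([Lperp_radical]).

    Off L^perp, translation by v changes the sign of i^q, so only L^perp
    contributes to G, and there the summand is constant on the cosets of L:
    G = #|L| times the sum of (-1)^(q/2) over L^perp / L
    ([gauss_subquotient]). That last sum is a positive number times
    (-1)^Arf ([gauss_Z2]), because a nonsingular alternating form has a
    symplectic basis ([symplectic_basis_exists]). Comparing the two signs found
    for G gives BK = 4 Arf. *)

(** * Characteristic 2 *)

Lemma addF2_eq0 (a b : 'F_2) : (a + b == 0) = (a == b).
Proof. by case: a b => [[|[|//]] ?] [[|[|//]] ?]. Qed.

Lemma F2_double (a : 'F_2) : a + a = 0.
Proof. by apply/eqP; rewrite addF2_eq0. Qed.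

Lemma F2v_double (V : vectType 'F_2) (x : V) : x + x = 0.
Proof. by rewrite -[x]scale1r -scalerDl F2_double scale0r. Qed.

Lemma F2v_add_eq0 (V : vectType 'F_2) (x y : V) : (x + y == 0) = (x == y).
Proof. by rewrite -(F2v_double y) (inj_eq (addIr y)). Qed.

Lemma F2_neq0 (a : 'F_2) : a != 0 -> a = 1.
Proof. by case: a => [[|[|//]] ?] // _; apply: val_inj. Qed.

Lemma two24K : cancel two24 half42.
Proof. by case=> [[|[|//]] ?]; apply: val_inj. Qed.

Lemma two24D a b : two24 (a + b) = two24 a + two24 b.
Proof. by case: a b => [[|[|//]] ?] [[|[|//]] ?]; apply: val_inj. Qed.

Lemma eq_opp0 (C : numDomainType) (x : C) : x = - x -> x = 0.
Proof.
by move/eqP; rewrite -addr_eq0 -mulr2n mulrn_eq0 => /eqP.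
Qed.

Lemma signF2D (A : pzRingType) (a b : 'F_2) :
  (-1) ^+ (a + b)%R = (-1) ^+ a * (-1) ^+ b :> A.
Proof.
by case: a b => [[|[|//]] ?] [[|[|//]] ?]; rewrite ?mulr1 ?mul1r // mulrNN mulr1.
Qed.

Lemma card_finvect (V : vectType 'F_2) : #|finvect_type V| = (2 ^ \dim {:V})%N.
Proof.
rewrite -(@card_vspacef 'F_2 (finvect_type V) (Vector.class V)) card_vspace.
by rewrite card_ord.
Qed.

(** * Symplectic bases and the Gauss sum of a quadratic form *)

Section SymplecticBasis.
Variables (W : vectType 'F_2) (mu : W -> W -> 'F_2).
Hypothesis mu_bil : bilinear_for *%R *%R mu.
Hypothesis mu_alt : forall x, mu x x = 0.

Let muDl x x' y : mu (x + x') y = mu x y + mu x' y.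
Proof. by have /= := mu_bil.1 y 1 x x'; rewrite scale1r mul1r. Qed.

Let muDr x y y' : mu x (y + y') = mu x y + mu x y'.
Proof. by have /= := mu_bil.2 x 1 y y'; rewrite scale1r mul1r. Qed.

Let mu0l y : mu 0 y = 0.
Proof. by apply: (addrI (mu 0 y)); rewrite -muDl !addr0. Qed.

Let muZl a x y : mu (a *: x) y = a * mu x y.
Proof. by have /= := mu_bil.1 y a x 0; rewrite addr0 mu0l addr0. Qed.

Let mu_sym x y : mu x y = mu y x.
Proof.
have := mu_alt (x + y); rewrite muDl !muDr !mu_alt add0r addr0.
by move/eqP; rewrite addF2_eq0 => /eqP.
Qed.

Let mu_suml I (r : seq I) (P : pred I) (u : I -> W) y :
  mu (\sum_(i <- r | P i) u i) y = \sum_(i <- r | P i) mu (u i) y.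
Proof. exact: (big_morph (mu^~ y) (fun x x' => muDl x x' y) (mu0l y)). Qed.

Definition symplectic_pair k (e f : k.-tuple W) : Prop :=
  forall i j, [/\ mu (tnth e i) (tnth e j) = 0, mu (tnth f i) (tnth f j) = 0
                & mu (tnth e i) (tnth f j) = (i == j)%:R].

Let mu_sum_e k (e f : k.-tuple W) (a b : 'I_k -> 'F_2) j :
  symplectic_pair e f ->
  mu (\sum_i a i *: tnth e i + \sum_i b i *: tnth f i) (tnth e j) = b j.
Proof.
move=> ef; rewrite muDl !mu_suml big1 ?add0r => [|i _]; last first.
  by rewrite muZl; have [->] := ef i j; rewrite mulr0.
rewrite (bigD1 j) //= muZl mu_sym; have [_ _ ->] := ef j j.
rewrite eqxx mulr1 big1 ?addr0 // => i ij.
by rewrite muZl mu_sym; have [_ _ ->] := ef j i; rewrite eq_sym (negPf ij) mulr0.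
Qed.

Let mu_sum_f k (e f : k.-tuple W) (a b : 'I_k -> 'F_2) j :
  symplectic_pair e f ->
  mu (\sum_i a i *: tnth e i + \sum_i b i *: tnth f i) (tnth f j) = a j.
Proof.
move=> ef; rewrite muDl !mu_suml [X in _ + X]big1 ?addr0 => [|i _]; last first.
  by rewrite muZl; have [_ ->] := ef i j; rewrite mulr0.
rewrite (bigD1 j) //= muZl; have [_ _ ->] := ef j j.
rewrite eqxx mulr1 big1 ?addr0 // => i ij.
by rewrite muZl; have [_ _ ->] := ef i j; rewrite (negPf ij) mulr0.
Qed.

(** The coefficients of a combination are recovered by pairing it with the
    dual vectors. *)
Lemma symplectic_pair_free k (e f : k.-tuple W) :
  symplectic_pair e f -> free (e ++ f).
Proof.
move=> ef; apply/(@freeP _ _ _ [tuple of e ++ f]) => c.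
rewrite big_split_ord /=.
under eq_bigr => i _ do rewrite nth_cat size_tuple ltn_ord -tnth_nth.
under [X in _ + X]eq_bigr => i _ do
  rewrite nth_cat size_tuple ltnNge leq_addr addKn -tnth_nth.
move=> c0 i; rewrite -(splitK i); case: (split i) => j /=.
  by have := mu_sum_f (c \o lshift k) (c \o @rshift k k) j ef; rewrite c0 mu0l.
by have := mu_sum_e (c \o lshift k) (c \o @rshift k k) j ef; rewrite c0 mu0l.
Qed.

Hypothesis mu_nondeg : forall x, (forall y, mu x y = 0) -> x = 0.

(** Orthogonal projection of x off the span of the two families. *)
Let orth_part k (e f : k.-tuple W) x :=
  x - (\sum_i mu x (tnth f i) *: tnth e i + \sum_i mu x (tnth e i) *: tnth f i).

Let mu_orth_part k (e f : k.-tuple W) x j : symplectic_pair e f ->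
  mu (orth_part e f x) (tnth e j) = 0 /\ mu (orth_part e f x) (tnth f j) = 0.
Proof.
move=> ef; rewrite /orth_part -scaleN1r !muDl !muZl.
by rewrite (mu_sum_e _ _ _ ef) (mu_sum_f _ _ _ ef) !mulN1r !subrr.
Qed.

(** A vector x outside the span has a nonzero projection x', which
    nondegeneracy pairs with some y; projecting y as well splits off a new
    hyperbolic plane. *)
Lemma symplectic_pair_extend k (e f : k.-tuple W) :
  symplectic_pair e f -> <<e ++ f>>%VS != fullv ->
  exists e' f' : k.+1.-tuple W, symplectic_pair e' f'.
Proof.
move=> ef nfull.
have [x _ xNef] : exists2 x : W, x \in fullv & x \notin <<e ++ f>>%VS.
  by apply/subvPn; apply: contra nfull => full; rewrite eqEsubv subvf.
have ef_span (a b : 'I_k -> 'F_2) :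
    \sum_i a i *: tnth e i + \sum_i b i *: tnth f i \in <<e ++ f>>%VS.
  apply: rpredD; apply: rpred_sum => i _; apply: rpredZ; apply: memv_span;
    by rewrite mem_cat mem_tnth ?orbT.
pose x' := orth_part e f x.
have x'_neq0 : x' != 0.
  by apply: contraNneq xNef => /eqP; rewrite subr_eq0 => /eqP->; apply: ef_span.
have x'_e j : mu x' (tnth e j) = 0 := (mu_orth_part x j ef).1.
have x'_f j : mu x' (tnth f j) = 0 := (mu_orth_part x j ef).2.
clearbody x'.
have [y xy] : exists y, mu x' y = 1.
  have [y /eqP xy|x'0] := pickP (fun y : finvect_type W => mu x' y == 1).
    by exists y.
  case/eqP: x'_neq0; apply: mu_nondeg => y; have := x'0 y.
  by case: (mu x' y) => [[|[|//]] ?] //= _; apply: val_inj.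
pose y' := orth_part e f y.
have y'_e j : mu y' (tnth e j) = 0 := (mu_orth_part y j ef).1.
have y'_f j : mu y' (tnth f j) = 0 := (mu_orth_part y j ef).2.
(* The part of y removed by the projection lies in the span, hence is
   orthogonal to x'. *)
have xy' : mu x' y' = 1.
  rewrite /y' /orth_part -scaleN1r muDr [mu x' (_ *: _)]mu_sym muZl muDl !mu_suml.
  by rewrite !big1 ?addr0 ?mulr0 ?addr0 // => i _;
    rewrite muZl [mu _ x']mu_sym (x'_e, x'_f) mulr0.
clearbody y'; exists [tuple of x' :: e], [tuple of y' :: f] => i j.
case: (unliftP ord0 i) => [i'|] ->; case: (unliftP ord0 j) => [j'|] ->;
  rewrite ?tnth0 ?tnthS ?mu_alt ?(inj_eq lift_inj) //.
by rewrite (mu_sym _ x') (mu_sym (tnth f _)) (mu_sym _ y') x'_e y'_f y'_e.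
Qed.

(** Pairs of families can be extended until they span; freeness bounds the
    number of extensions. *)
Lemma symplectic_basis_exists : exists B, symplectic_basis mu B.
Proof.
suff [k [e [f [ef full]]]] : exists k (e f : k.-tuple W),
    symplectic_pair e f /\ <<e ++ f>>%VS = fullv.
  have ef_basis : basis_of {:W} (e ++ f).
    by rewrite /basis_of full eqxx symplectic_pair_free.
  have /eqP kE : k == (\dim {:W})./2.
    have /andP[/eqP <- /eqP->] := ef_basis.
    by rewrite size_cat !size_tuple addnn doubleK.
  subst k; exists (e, f); rewrite /symplectic_basis ef_basis /=.
  apply/forallP => i; apply/forallP => j.
  by have [-> -> ->] := ef i j; rewrite !eqxx.
(* Each extension raises k by 1, so the slack m bounds their number. *)
suff ext m k (e f : k.-tuple W) : symplectic_pair e f ->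
    (\dim {:W} <= m + k)%N ->
    exists k (e f : k.-tuple W), symplectic_pair e f /\ <<e ++ f>>%VS = fullv.
  by apply: (ext (\dim {:W}) 0 [tuple] [tuple]) => [[]|]; rewrite ?addn0.
elim: m k e f => [|m IHm] k e f ef dimW.
  exists k, e, f; split=> //; apply/eqP; rewrite eqEdim subvf.
  have /eqP-> := symplectic_pair_free ef.
  by rewrite size_cat !size_tuple (leq_trans dimW) ?leq_addr.
have [full|nfull] := eqVneq <<e ++ f>>%VS fullv; first by exists k, e, f.
have [e' [f' ef']] := symplectic_pair_extend ef nfull.
by apply: IHm ef' _; rewrite -addSnnS.
Qed.

End SymplecticBasis.

(** The value of h at x + x = 0 is mu x x. *)
Lemma nonsingular_Z2_form_alternating (W : vectType 'F_2) mu h :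
  @nonsingular_Z2_form W mu h -> forall x, mu x x = 0.
Proof.
move=> [mu_bil _ _ hD] x.
have mu0 : mu 0 0 = 0.
  by have /= := mu_bil.1 0 1 0 0; rewrite scaler0 addr0 mul1r F2_double.
have h0 : h 0 = 0 by have := hD 0 0; rewrite addr0 mu0 addr0 F2_double.
by have := hD x x; rewrite F2v_double h0 F2_double add0r.
Qed.

Lemma gauss_Z2 (W : vectType 'F_2) mu h : @nonsingular_Z2_form W mu h ->
  \sum_(x : finvect_type W) (-1) ^+ h x =
    2 ^+ (\dim {:W})./2 * (-1) ^+ Arf mu h :> int.
Proof.
move=> mu_h; have [mu_bil _ mu_nondeg _] := mu_h.
have [B B_sympl] := symplectic_basis_exists mu_bil
  (nonsingular_Z2_form_alternating mu_h) mu_nondeg.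
by rewrite (Gauss_sum_Arf mu_h B_sympl) (Arf_basis mu_h B_sympl).
Qed.

(** * The Gauss sum of a quadratic enhancement with values in 'Z_4 *)

Section Phases.
Variable R : realType.
Local Notation C := R[i].
Local Notation I := ('i%C : C).

Lemma exprI_Z4D (a b : 'Z_4) : I ^+ (a + b)%R = I ^+ a * I ^+ b.
Proof.
have I4 : I ^+ 4 = 1 by rewrite (exprM _ 2 2) sqr_i sqrrN expr1n.
by rewrite -exprD -[RHS](expr_mod _ I4).
Qed.

Lemma exprI_two24 (a : 'F_2) : I ^+ two24 a = (-1) ^+ a.
Proof.
by case: a => [[|[|//]] ?]; rewrite /two24 //= expr1 -sqr_i.
Qed.

Definition zeta8 : C := expi (pi / 4).

Lemma expiD (s t : R) : expi (s + t) = expi s * expi t.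
Proof. by rewrite /expi cosD sinD; simpc; rewrite [sin s * _ + _]addrC. Qed.

(** Turns the phases in the definition of [BK] into powers of one root of
    unity, of which only [zeta8_sqr] has to be known. *)
Lemma expi_zeta8 n : expi (2 * pi * n%:R / 8) = zeta8 ^+ n.
Proof.
elim: n => [|n IHn]; first by rewrite mulr0 mul0r /expi cos0 sin0.
by rewrite exprS -IHn -expiD; congr expi; rewrite -natr1; field.
Qed.

Lemma zeta8_sqr : zeta8 ^+ 2 = I.
Proof.
rewrite expr2 -expiD (_ : _ + _ = pi / 2); last by field.
by rewrite /expi cos_pihalf sin_pihalf.
Qed.

Lemma zeta8_exp4 : zeta8 ^+ 4 = -1.
Proof. by rewrite (exprM _ 2 2) zeta8_sqr sqr_i. Qed.

Local Notation gauss V q := (\sum_(x : finvect_type V) I ^+ (q : V -> 'Z_4) x).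
Local Notation sqrt2 := ((Num.sqrt (2 : R))%:C%C : C).

Lemma sqrt2_sqr : sqrt2 ^+ 2 = 2.
Proof. by rewrite -rmorphXn sqr_sqrtr // rmorph_nat. Qed.

Section Enhancement.
Variables (V : vectType 'F_2) (lambda : {symmetric V}) (q : V -> 'Z_4) (v : V).
Hypothesis ns : nondegenerate lambda.
Hypothesis hq : Z4_enhancement lambda q.
Hypothesis hv : characteristic_element lambda v.

Lemma lambdaC x y : lambda x y = lambda y x.
Proof. by rewrite (hermC lambda) expr0 mul1r. Qed.

Lemma nondegenerate_eq0 x : (forall y, lambda x y = 0) -> x = 0.
Proof.
move=> x0; apply/eqP; rewrite -memv0 -(eqP ns) memvE.
apply/orthovP => _ y /vlineP[a ->] _.
by rewrite linearZl_LR /= x0 mulr0.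
Qed.

(** Orthogonality of characters: for y <> 0, translation by some x0 with
    lambda x0 y = 1 changes the sign of the sum. *)
Lemma sum_sign_lambda y :
  \sum_(x : finvect_type V) (-1) ^+ lambda x y
    = (if y == 0 then 2 ^+ \dim {:V} else 0) :> C.
Proof.
case: eqVneq => [->|y_neq0].
  under eq_bigr => x _ do rewrite linear0r expr0.
  by rewrite sumr_const card_finvect natrX.
have [x0 xy] : exists x0 : V, lambda x0 y = 1.
  have [x0 /eqP xy|x0] := pickP (fun x0 : finvect_type V => lambda x0 y == 1).
    by exists x0.
  case/eqP: y_neq0; apply: nondegenerate_eq0 => x; rewrite lambdaC; have := x0 x.
  by case: (lambda x y) => [[|[|//]] ?] //= _; apply: val_inj.
apply: eq_opp0; rewrite {1}(reindex_inj (addIr (x0 : finvect_type V))) /=.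
rewrite -sumrN; apply: eq_bigr => x _.
by rewrite linearDl /= xy signF2D mulrN1.
Qed.

(** The enhancement property at x + x = 0; in particular q x is even exactly
    when lambda x x = 0. *)
Lemma q_double x : q x + q x = two24 (lambda x x).
Proof.
have l0 : lambda 0 0 = 0 by rewrite linear0r.
have q0 : q 0 = 0.
  apply: (addrI (q 0)); have := hq 0 0.
  by rewrite !addr0 l0 /two24 muln0 addr0 => <-.
have := hq x x; rewrite F2v_double q0 => /esym/eqP.
rewrite addr_eq0 => /eqP->.
by case: (lambda x x) => [[|[|//]] ?]; apply: val_inj.
Qed.

(** Substituting y = x + z in the double sum leaves, for each z, a character
    sum over x which vanishes unless z = v. *)
Lemma gauss_sqr : gauss V q ^+ 2 = I ^+ q v * 2 ^+ \dim {:V}.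
Proof.
transitivity (\sum_(z : finvect_type V) I ^+ q z *
    \sum_(x : finvect_type V) (-1) ^+ lambda x (v + z) : C).
  under [RHS]eq_bigr => z _ do rewrite mulr_sumr.
  rewrite exchange_big expr2 mulr_suml /=; apply: eq_bigr => x _.
  rewrite mulr_sumr (reindex_inj (addrI x)) /=; apply: eq_bigr => z _.
  rewrite hq !exprI_Z4D exprI_two24 !mulrA -exprI_Z4D q_double exprI_two24.
  by rewrite hv linearDr signF2D /= -mulrA mulrCA mulrA.
rewrite (bigD1 (v : finvect_type V)) //= sum_sign_lambda F2v_double eqxx.
rewrite big1 ?addr0 // => z zv.
by rewrite sum_sign_lambda F2v_add_eq0 eq_sym (negPf zv) mulr0.
Qed.

(** By [gauss_sqr] the sum is plus or minus sqrt 2 ^+ dim V * zeta8 ^+ q v, so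
    q v or q v + 4 solves the equation that defines [BK]. *)
Lemma gauss_BK : gauss V q = sqrt2 ^+ \dim {:V} * zeta8 ^+ BK R q.
Proof.
rewrite /BK; case: pickP => [b /eqP->|noBK]; first by rewrite /= expi_zeta8.
suff [b hb] : exists b : 'Z_8, gauss V q = sqrt2 ^+ \dim {:V} * zeta8 ^+ b.
  by have := noBK b; rewrite hb expi_zeta8 eqxx.
have : gauss V q ^+ 2 == (sqrt2 ^+ \dim {:V} * zeta8 ^+ q v) ^+ 2.
  rewrite gauss_sqr exprMn -!exprM mulnC [(q v * 2)%N]mulnC !exprM.
  by rewrite sqrt2_sqr zeta8_sqr mulrC.
have q_lt := ltn_ord (q v).
rewrite eqf_sqr => /orP[] /eqP ->.
  by exists (inZp (q v)); rewrite /= modn_small // (ltn_trans q_lt).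
exists (inZp (q v + 4)); rewrite /= modn_small ?exprD ?zeta8_exp4 ?mulrN1 ?mulrN //.
by rewrite -[8%N]/(4 + 4)%N ltn_add2r.
Qed.

Hypothesis hBK : (4 %| BK R q)%N.

Lemma zeta8_BK : zeta8 ^+ BK R q = 1 \/ zeta8 ^+ BK R q = -1.
Proof.
case/dvdnP: hBK => k ->; rewrite mulnC exprM zeta8_exp4 -signr_odd.
by case: (odd k); [right | left].
Qed.

(** The sum is real by [zeta8_BK], so its square is positive, whereas
    [gauss_sqr] gives this square the phase 'i ^+ q v. *)
Lemma q_char_eq0 : q v = 0.
Proof.
have /eqP : I ^+ q v * 2 ^+ \dim {:V} = 2 ^+ \dim {:V}.
  rewrite -gauss_sqr gauss_BK exprMn -!exprM mulnC exprM sqrt2_sqr.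
  rewrite exprM; case: zeta8_BK => ->; by rewrite ?sqrrN expr1n mulr1.
rewrite -{2}[2 ^+ _]mul1r (inj_eq (mulIf _)) ?expf_neq0 ?pnatr_eq0 //.
case: (q v) => [[|[|[|[|//]]]] ?] /=; first by move=> _; apply: val_inj.
- by rewrite expr1 eq_complex /= oner_eq0 andbF.
- by rewrite sqr_i eq_sym -addr_eq0 -mulr2n pnatr_eq0.
- rewrite exprS sqr_i mulrN1 eq_complex /=; simpc.
  by rewrite oppr_eq0 oner_eq0 andbF.
Qed.

End Enhancement.
End Phases.

(** * The subquotient L^perp / L *)

Section Subquotient.
Variables (V : vectType 'F_2) (lambda : {symmetric V}) (q : V -> 'Z_4) (v : V).
Hypothesis ns : nondegenerate lambda.
Hypothesis hq : Z4_enhancement lambda q.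
Hypothesis hv : characteristic_element lambda v.
Hypothesis qv : q v = 0.

Local Notation P := (Lperp lambda).
Local Notation W := (LperpL lambda v).
Local Notation pi := (LperpL_pi v).

Lemma lambda_v_eq0 : lambda v v = 0.
Proof. by apply: (can_inj two24K); rewrite -(q_double hq) qv addr0. Qed.

Lemma vline_sub_Lperp : (<[v]> <= P)%VS.
Proof. by rewrite -memvE mem_Lperp lambda_v_eq0. Qed.

Lemma mem_vlineF2 x : x \in <[v]>%VS -> x = 0 \/ x = v.
Proof.
case/vlineP=> -[[|[|//]] ?] ->.
  by left; rewrite -[RHS](scale0r v); congr (_ *: _); apply: val_inj.
by right; rewrite -[RHS](scale1r v); congr (_ *: _); apply: val_inj.
Qed.

Lemma Lperp_pair_v x : x \in P -> lambda x v = 0.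
Proof. by rewrite mem_Lperp hv => /eqP. Qed.

Lemma q_Lperp_even x : x \in P -> two24 (half42 (q x)) = q x.
Proof.
rewrite mem_Lperp => /eqP xx; have := q_double hq x; rewrite xx.
by case: (q x) => [[|[|[|[|//]]]] ?] // _; apply: val_inj.
Qed.

Lemma LperpL_repr_in (w : W) : LperpL_repr w \in P.
Proof. exact: subvsP. Qed.

Lemma LperpL_pi_reprK (w : W) : pi (vsproj P (LperpL_repr w)) = w.
Proof. by rewrite /LperpL_repr vsvalK; apply: vquot_reprK. Qed.

(** Describes the coset w as a translate of the line of v inside V, without
    reference to the quotient. *)
Lemma eq_LperpL_pi x (w : W) : x \in P ->
  (pi (vsproj P x) == w) = (x - LperpL_repr w \in <[v]>%VS).
Proof.
move=> xP; rewrite -{1}[w]vquot_reprK [LHS]eq_vquot_pi -memv_preim lfunE /=.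
by rewrite vsprojK.
Qed.

Lemma LperpL_repr_pi (x : subvs_of P) :
  LperpL_repr (pi x) = vsval x \/ LperpL_repr (pi x) = vsval x + v.
Proof.
have : vsval x - LperpL_repr (pi x) \in <[v]>%VS.
  by rewrite -eq_LperpL_pi ?subvsP // vsvalK.
case/mem_vlineF2 => /eqP; rewrite subr_eq => /eqP.
  by rewrite add0r; left.
by move->; right; rewrite addrAC F2v_double add0r.
Qed.

Lemma induced_form_pi (x y : subvs_of P) :
  induced_form (pi x) (pi y) = lambda (vsval x) (vsval y).
Proof.
have xv := Lperp_pair_v (subvsP x); have yv := Lperp_pair_v (subvsP y).
rewrite /induced_form.
case: (LperpL_repr_pi x) => ->; case: (LperpL_repr_pi y) => ->;
  by rewrite ?(linearDl, linearDr) /= ?xv ?(lambdaC _ v) ?yv ?lambda_v_eq0 ?addr0.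
Qed.

Lemma induced_half_pi (x : subvs_of P) :
  two24 (induced_half q (pi x)) = q (vsval x).
Proof.
have xP := subvsP x.
rewrite q_Lperp_even ?LperpL_repr_in //.
case: (LperpL_repr_pi x) => -> //.
by rewrite hq qv (Lperp_pair_v xP) /two24 muln0 !addr0.
Qed.

Lemma LperpL_piP (w : W) : exists x : subvs_of P, w = pi x.
Proof. by exists (vsproj P (LperpL_repr w)); rewrite LperpL_pi_reprK. Qed.

(** If x pairs to 0 with L^perp, the kernel of lambda _ v, then lambda x is a
    multiple of lambda v; so x is 0 or v by nondegeneracy. *)
Lemma Lperp_radical x : (forall y, y \in P -> lambda x y = 0) -> x \in <[v]>%VS.
Proof.
move=> xP0.
have [y0 xy0|x0] := pickP (fun y : finvect_type V => lambda x y != 0); last first.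
  rewrite (nondegenerate_eq0 ns (x := x)) ?mem0v // => y.
  by have := x0 y => /negbFE/eqP.
have y0v : lambda (y0 : V) v = 1.
  by apply: F2_neq0; apply: contra xy0; rewrite -hv -mem_Lperp => /xP0->.
suff /eqP : x + v = 0 by rewrite F2v_add_eq0 => /eqP->; apply: memv_line.
apply: (nondegenerate_eq0 ns) => y; rewrite linearDl /= (lambdaC _ v).
have [yv|/F2_neq0 yv] := eqVneq (lambda y v) 0.
  by rewrite yv xP0 ?addr0 // mem_Lperp hv yv.
have : lambda x (y + y0) = 0.
  by apply: xP0; rewrite mem_Lperp hv linearDl /= yv y0v F2_double.
by rewrite linearDr /= (F2_neq0 xy0) yv.
Qed.

Lemma nonsingular_induced :
  nonsingular_Z2_form (@induced_form V lambda v) (induced_half q).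
Proof.
split.
- split=> [w a w1 w2|w a w1 w2] /=;
    case: (LperpL_piP w) (LperpL_piP w1) (LperpL_piP w2) => x -> [y ->] [z ->];
    rewrite -(linearP (@vquot_pi _ _ _)) !induced_form_pi [vsval (_ + _)]linearP.
    by rewrite linearDl linearZl_LR.
  by rewrite linearDr linearZr.
- by move=> w1 w2; apply: lambdaC.
- move=> w; have [x ->] := LperpL_piP w => x0; apply/eqP.
  rewrite -(linear0 (@vquot_pi _ _ _)) eq_vquot_pi subr0 -memv_preim lfunE /=.
  by apply: Lperp_radical => y yP; rewrite -(vsprojK yP) -induced_form_pi x0.
- move=> w1 w2; case: (LperpL_piP w1) (LperpL_piP w2) => x -> [y ->].
  apply: (can_inj two24K); rewrite !two24D -(linearD (@vquot_pi _ _ _)).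
  by rewrite !induced_half_pi induced_form_pi /= hq.
Qed.

Section GaussSum.
Variable R : realType.
Local Notation C := R[i].
Local Notation I := ('i%C : C).

(** Off L^perp the terms cancel: there q (x + v) = q x + 2. *)
Lemma gauss_Lperp :
  \sum_(x : finvect_type V) I ^+ q x =
  \sum_(x : finvect_type V | (x : V) \in P) I ^+ q x.
Proof.
rewrite (bigID (fun x : finvect_type V => (x : V) \in P)) /=.
rewrite [X in _ + X]eq_opp0 ?addr0 //.
rewrite {1}(reindex_inj (addIr (v : finvect_type V))) /= -sumrN.
have Pv x : (x + v \in P) = (x \in P).
  by rewrite rpredDr // (subvP vline_sub_Lperp) ?memv_line.
apply: eq_big => [x|x]; rewrite Pv // => xP.
rewrite hq qv addr0 exprI_Z4D exprI_two24.
move: xP; rewrite mem_Lperp hv.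
by case: (lambda x v) => [[|[|//]] ?] // _; rewrite mulrN1.
Qed.

(** The summand is constant on the cosets of L in L^perp, all of size #|L|. *)
Lemma gauss_subquotient :
  \sum_(x : finvect_type V) I ^+ q x =
  #|[pred x : finvect_type V | (x : V) \in <[v]>%VS]|%:R *
  \sum_(w : finvect_type W) (-1) ^+ induced_half q w.
Proof.
rewrite gauss_Lperp mulr_sumr.
rewrite (partition_big (fun x : finvect_type V => pi (vsproj P x) : finvect_type W)
  xpredT) //=.
apply: eq_bigr => w _; pose r : finvect_type V := LperpL_repr w.
rewrite (reindex_inj (addIr r)) mulr_natl -sumr_const /=.
have addP x : (x : V) \in <[v]>%VS -> x + LperpL_repr w \in P.
  by move=> xv; rewrite rpredD ?LperpL_repr_in // (subvP vline_sub_Lperp).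
apply: eq_big => [x|x /andP[xP /eqP <-]].
  rewrite inE; apply/andP/idP => [[xP]|xv].
    by rewrite eq_LperpL_pi // addrK.
  by split; [apply: addP | rewrite eq_LperpL_pi ?addP ?addrK].
by rewrite -exprI_two24 induced_half_pi vsprojK.
Qed.

End GaussSum.
End Subquotient.

Theorem proposition2p4p5 (R : realType) (V : vectType 'F_2)
  (lambda : {symmetric V}) (q : V -> 'Z_4) (v : V)
  (ns : nondegenerate lambda)
  (hq : Z4_enhancement lambda q)
  (hv : characteristic_element lambda v)
  (hBK : (4 %| BK R q)%N) :
  [/\ (<[v]> <= Lperp lambda)%VS,
      forall x y : subvs_of (Lperp lambda),
        induced_form (LperpL_pi v x) (LperpL_pi v y)
        = lambda (vsval x) (vsval y),
      forall x : subvs_of (Lperp lambda),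
        two24 (induced_half q (LperpL_pi v x)) = q (vsval x),
      nonsingular_Z2_form (@induced_form V lambda v) (induced_half q)
    & BK R q = four28 (Arf (@induced_form V lambda v) (induced_half q))].
Proof.
have qv : q v = 0 := q_char_eq0 ns hq hv hBK.
have W_ns := nonsingular_induced ns hq hv qv.
split=> //.
- exact: vline_sub_Lperp hq qv.
- exact: induced_form_pi.
- exact: induced_half_pi.
set arf := Arf _ _.
(* G = c * (-1) ^+ Arf with c > 0, to be compared with the sign of G given by
   [gauss_BK]. *)
pose c := (#|[pred x : finvect_type V | (x : V) \in <[v]>%VS]| *
  2 ^ (\dim {:LperpL lambda v})./2)%N.
have c_gt0 : 0 < c%:R :> R[i].
  rewrite ltr0n muln_gt0 expn_gt0 andbT; apply/card_gt0P.
  by exists (0 : V); rewrite inE mem0v.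
have := gauss_subquotient hq hv qv R.
rewrite (gauss_BK R ns hq hv).
have -> : \sum_(w : finvect_type (LperpL lambda v)) (-1) ^+ induced_half q w
    = ((2 ^+ (\dim {:LperpL lambda v})./2 * (-1) ^+ arf : int)%:~R : R[i]).
  rewrite -(gauss_Z2 W_ns) rmorph_sum; apply: eq_bigr => w _.
  by rewrite rmorphXn rmorphN1.
rewrite rmorphM !rmorphXn rmorphN1 mulrA -natrX -natrM -/c.
set s := Num.sqrt _.
have : 0 < s%:C%C ^+ \dim {:V} :> R[i].
  by rewrite exprn_gt0 // ltcR sqrtr_gt0 ltr0n.
move: (s%:C%C ^+ _) => d d_gt0 dc.
have not_opp : d = - c%:R -> False.
  by move=> dE; move: d_gt0; rewrite dE oppr_gt0 => /(lt_trans c_gt0); rewrite ltxx.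
(* Only the classes 0 and 4 of 'Z_8 survive the divisibility hypothesis. *)
move: (BK R q) hBK dc => [[|[|[|[|[|[|[|[|//]]]]]]]] i] // _ /=.
  rewrite mulr1; case: arf => [[|[|//]] j] /=; first by move=> _; apply: val_inj.
  by rewrite expr1 mulrN1 => /not_opp.
rewrite zeta8_exp4 mulrN1; case: arf => [[|[|//]] j] /=; last first.
  by move=> _; apply: val_inj.
by rewrite expr0 mulr1 => /(canRL opprK)/not_opp.
Qed.
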